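(* Let $n\ge k\ge 2$ be integers. Then: (i) for $n\ge 2k-1$, it holds for every graph $Y$ of order $n$ that $\mathrm{FS}(\mathrm{Lollipop}_{n-k,k},Y)$ is connected if and only if $\mathrm{FS}(\mathrm{Dand}_{n-k,k},Y)$ is connected; (ii) for $k\le n\le 2k-2$, the following statement does not hold: for every graph $Y$ of order $n$, $\mathrm{FS}(\mathrm{Lollipop}_{n-k,k},Y)$ is connected if and only if $\mathrm{FS}(\mathrm{Dand}_{n-k,k},Y)$ is connected.
   Context: All graphs are simple; the order of a graph is its number of vertices. For two graphs $X,Y$ of the same order $n$, the friends-and-strangers graph $\mathrm{FS}(X,Y)$ has as vertices all bijections $\sigma:V(X)\to V(Y)$; two bijections $\sigma,\sigma'$ are adjacent if and only if there are distinct $a,b\in V(X)$ with $ab\in E(X)$, $\sigma(a)\sigma(b)\in E(Y)$, $\sigma(a)=\sigma'(b)$, $\sigma(b)=\sigma'(a)$, and $\sigma(c)=\sigma'(c)$ for all $c\in V(X)\setminus\{a,b\}$. $P_m$, $K_m$, $S_m$ denote the path, complete graph and star of order $m$. The lollipop graph $\mathrm{Lollipop}_{n-k,k}$ of order $n$ is obtained by identifying one end of $P_{n-k+1}$ with a vertex of $K_k$. The dandelion graph $\mathrm{Dand}_{n-k,k}$ of order $n$ is obtained by identifying one end of $P_{n-k+1}$ with the center vertex of $S_k$. (When $n=k$ these are $K_n$ and $S_n$.)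
   Formalization: Part (ii) is stated with the extra assumption k ≥ 3, which excludes only n = k = 2; there the lollipop K_2 and the dandelion S_2 coincide, so the equivalence holds for every Y and (ii) as printed is false. *)

(* Defs.v *)
From mathcomp Require Import all_boot.

Set Implicit Arguments.
Unset Strict Implicit.
Unset Printing Implicit Defensive.

Record sgraph := SGraph {
  svertex :> finType;
  sedge : rel svertex;
  sedge_sym : symmetric sedge;
  sedge_irrefl : irreflexive sedge }.

Definition connected (G : sgraph) : Prop :=
  0 < #|G| /\ forall x y : G, connect (@sedge G) x y.

Section FriendsAndStrangers.
Variables X Y : sgraph.

Definition bijectiveb (s : {ffun X -> Y}) : bool :=
  injectiveb s && [forall y, y \in codom s].

Definition bijection := {s : {ffun X -> Y} | bijectiveb s}.

Definition FS_edge : rel bijection := fun s t =>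
  [exists a, exists b,
    [&& a != b, sedge a b, sedge (val s a) (val s b),
        val s a == val t b, val s b == val t a &
        [forall c, (c != a) && (c != b) ==> (val s c == val t c)]]].

Lemma FS_edge_sym : symmetric FS_edge.
Proof.
suff FS_edgeW s t : FS_edge s t -> FS_edge t s.
  by move=> s t; apply/idP/idP; apply: FS_edgeW.
case/existsP=> a /existsP[b /and5P[ab Xab Yab sa_tb /andP[sb_ta /forallP st]]].
apply/existsP; exists a; apply/existsP; exists b.
rewrite ab Xab -(eqP sa_tb) -(eqP sb_ta) sedge_sym Yab !eqxx /=.
by apply/forallP=> c; rewrite [val t c == _]eq_sym; exact: st.
Qed.

Lemma FS_edge_irrefl : irreflexive FS_edge.
Proof.
move=> s; apply/negbTE/negP=> /existsP[a /existsP[b /and5P[ab _ _ sab _]]].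
have /andP[/injectiveP s_inj _] := valP s.
by case/eqP: ab; apply: s_inj; apply/eqP.
Qed.

Definition FS : sgraph := SGraph FS_edge_sym FS_edge_irrefl.

End FriendsAndStrangers.

(* In both families the vertices are 0, ..., n - 1: the path P_{n-k+1} is
   0 - 1 - ... - (n - k), and K_k, resp. S_k, lives on n - k, ..., n - 1. The
   identified vertex is n - k, which is the center of S_k. The definitions
   are meant for 0 < k <= n only. *)
Section LollipopDandelion.
Variables n k : nat.

Definition tail_edge : rel 'I_n := fun i j =>
  [&& i <= n - k, j <= n - k & (i.+1 == j) || (j.+1 == i)].

Definition clique_edge : rel 'I_n := fun i j =>
  [&& n - k <= i, n - k <= j & i != j].

Definition star_edge : rel 'I_n := fun i j =>
  (i == n - k :> nat) && (n - k < j) || (j == n - k :> nat) && (n - k < i).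

Lemma tail_edge_sym : symmetric tail_edge.
Proof. by move=> i j; rewrite /tail_edge andbCA orbC. Qed.

Lemma tail_edge_irrefl : irreflexive tail_edge.
Proof. by move=> i; rewrite /tail_edge gtn_eqF // !andbF. Qed.

Lemma clique_edge_sym : symmetric clique_edge.
Proof. by move=> i j; rewrite /clique_edge andbCA eq_sym. Qed.

Lemma clique_edge_irrefl : irreflexive clique_edge.
Proof. by move=> i; rewrite /clique_edge eqxx !andbF. Qed.

Lemma star_edge_sym : symmetric star_edge.
Proof. by move=> i j; rewrite /star_edge orbC. Qed.

Lemma star_edge_irrefl : irreflexive star_edge.
Proof. by move=> i; rewrite /star_edge orbb; case: ltngtP. Qed.

Definition lollipop_edge : rel 'I_n := fun i j =>
  tail_edge i j || clique_edge i j.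

Definition dandelion_edge : rel 'I_n := fun i j =>
  tail_edge i j || star_edge i j.

Lemma lollipop_sym : symmetric lollipop_edge.
Proof.
by move=> i j; rewrite /lollipop_edge tail_edge_sym clique_edge_sym.
Qed.

Lemma lollipop_irrefl : irreflexive lollipop_edge.
Proof.
by move=> i; rewrite /lollipop_edge tail_edge_irrefl clique_edge_irrefl.
Qed.

Lemma dandelion_sym : symmetric dandelion_edge.
Proof.
by move=> i j; rewrite /dandelion_edge tail_edge_sym star_edge_sym.
Qed.

Lemma dandelion_irrefl : irreflexive dandelion_edge.
Proof.
by move=> i; rewrite /dandelion_edge tail_edge_irrefl star_edge_irrefl.
Qed.

Definition lollipop : sgraph := SGraph lollipop_sym lollipop_irrefl.

Definition dandelion : sgraph := SGraph dandelion_sym dandelion_irrefl.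

End LollipopDandelion.

(* K_2 = S_2, so the two families agree at n = k = 2 and no Y can tell them
   apart there, although k <= n <= 2k - 2 holds. *)
Lemma lollipop22_dandelion22 (Y : sgraph) :
  connected (FS (lollipop 2 2) Y) <-> connected (FS (dandelion 2 2) Y).
Proof.
have edgeE : lollipop_edge 2 (n := 2) =2 dandelion_edge 2 (n := 2).
  by case=> [[|[|//]]] ? [[|[|//]]].
have FS_edgeE : @FS_edge (lollipop 2 2) Y =2 @FS_edge (dandelion 2 2) Y.
  move=> s t; rewrite /FS_edge; apply: eq_existsb => a; apply: eq_existsb => b.
  by rewrite /= edgeE.
have FS_connectE := eq_connect FS_edgeE.
by split=> -[FS_gt0 FS_conn]; (split; first exact: FS_gt0) => s t;
  [rewrite -[connect _ _ _]FS_connectE | rewrite [connect _ _ _]FS_connectE];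
  exact: FS_conn.
Qed.

(* Main.v *)
Require Import Defs.
From mathcomp Require Import all_boot all_fingroup zify.

(** View the vertices of the lollipop or dandelion as positions, and those of [Y]
    as people who swap places when they are friends and stand at adjacent
    positions. The tail consists of the positions below [n - k], the center is
    [n - k], and the others are the leaves, or the rest of the clique.

    Lollipops are governed by the connectivity of [Y]: the friends-and-strangers
    graph is connected if and only if every set of at least [k] people induces a
    connected subgraph, that is, [Y] is (n-k+1)-connected. It is necessary
    because, for a set [B] of at least [k] people, the component of the leftmost
    member of [B] never changes ([leftmost_in_edge]). It is sufficient because
    one can fill the tail person by person, after which the clique can be
    permuted at will ([agree_connect], [clique_swap]).

    For [n >= 2k - 1], suppose that the lollipop graph is connected. By the
    necessary condition each person [w] has at least [n - k + 1] friends; this is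
    at least [k], so the friends of [w] induce a connected graph themselves, and
    [k - 1] of them can be chosen that still do ([exists_hub]). Put [w] at the
    center and those on the leaves. Two of them who are friends form a triangle
    with [w], and three dandelion moves around the triangle exchange them; by
    connectedness all permutations of the leaves become possible ([hub_swap]).
    As permuting leaves is an automorphism of the dandelion, the same then holds
    throughout the component of that placement, so all lollipop moves stay within
    this component ([swap_closed_connected]), which is therefore everything.
    Conversely the dandelion is a subgraph of the lollipop.

    For [n <= 2k - 2], let [Y] be complete bipartite with sides of sizes
    [n - k + 1] and [k - 1], both less than [k]. Any [k] people then meet both
    sides and induce a connected graph, so the lollipop graph is connected. But
    the dandelion is bipartite too, and for two bipartite graphs the signature of
    a placement determines, within a component, the parity of the number of
    people of the first side standing at positions of the first color
    ([bipartite_FS_disconnected]). *)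

Set Implicit Arguments.
Unset Strict Implicit.
Unset Printing Implicit Defensive.

(** * Connected induced subgraphs *)

Section Induced.
Variable Y : sgraph.
Implicit Types (B N : {set Y}) (x y : Y).

(** Restricting both ends, not only the target, keeps the relation symmetric. *)
Definition induced_edge B : rel Y :=
  fun x y => [&& x \in B, y \in B & sedge x y].

Definition induced_connected B :=
  forall x y, x \in B -> y \in B -> connect (induced_edge B) x y.

Lemma induced_connect_sym B : connect_sym (induced_edge B).
Proof.
by apply: sym_connect_sym => x y; rewrite /induced_edge andbCA sedge_sym.
Qed.

Lemma induced_connect_ind B (P : Y -> Prop) x y :
    connect (induced_edge B) x y -> P x ->
    (forall u v, u \in B -> v \in B -> sedge u v -> P u -> P v) ->
  P y.
Proof.
case/connectP=> p + -> + PB; elim: p x => //= u p IHp x.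
by case/andP=> /and3P[xB uB xu] up Px; apply: (IHp u) => //; apply: PB xu Px.
Qed.

Lemma induced_connectedU1 B u v :
  induced_connected B -> u \in B -> sedge u v -> induced_connected (v |: B).
Proof.
move=> Bconn uB uv.
have toB x : x \in v |: B -> connect (induced_edge (v |: B)) x u.
  case/setU1P=> [->|xB].
    by apply: connect1; rewrite /induced_edge setU11 setU1r // sedge_sym.
  apply: connect_sub (Bconn x u xB uB) => y z /and3P[yB zB yz].
  by apply: connect1; rewrite /induced_edge !setU1r.
move=> x y /toB xu /toB yu; apply: connect_trans xu _.
by rewrite induced_connect_sym.
Qed.

(** A connected set contains connected sets of every smaller nonzero size:
    grow one from a singleton, adding each time a vertex joined to it. *)
Lemma induced_connected_subset N m :
    induced_connected N -> 0 < m <= #|N| ->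
  exists B : {set Y}, [/\ B \subset N, #|B| = m & induced_connected B].
Proof.
move=> Nconn; elim: m => // -[_ /andP[_ N_gt0]|m IHm /andP[_ m_lt]].
  have [x xN] := card_gt0P N_gt0.
  exists [set x]; split; rewrite ?sub1set ?cards1 //.
  by move=> y z /set1P-> /set1P->.
have [|B [sBN cardB Bconn]] := IHm; first by rewrite /= ltnW.
have [x xB] : exists x, x \in B by apply/card_gt0P; rewrite cardB.
have [/existsP[u /existsP[v /and4P[uB vN vB uv]]]|no_edge] :=
    boolP [exists u, exists v, [&& u \in B, v \in N, v \notin B & sedge u v]].
  exists (v |: B); split; last exact: induced_connectedU1 uv.
  - by rewrite subUset sub1set vN.
  - by rewrite cardsU1 vB cardB.
case: (ltnP #|B| #|N|) => [|]; last by rewrite cardB leqNgt m_lt.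
rewrite ltnNge => /negP[]; apply: subset_leq_card; apply/subsetP=> y yN.
apply: (induced_connect_ind (P := fun z => z \in B) (Nconn x y _ yN)) => //.
  exact: (subsetP sBN).
move=> u v _ vN uv uB; apply: contraNT no_edge => vB.
by apply/existsP; exists u; apply/existsP; exists v; rewrite uB vN vB.
Qed.

End Induced.

(** * Bijections as placements of people

    The vertices of [X] are positions, those of [Y] are people, and a bijection
    [s] tells who stands where. *)

Section States.
Variables X Y : sgraph.
Implicit Types s t : bijection X Y.

Lemma bijection_inj s : injective (val s).
Proof. by case/andP: (valP s) => /injectiveP. Qed.

Lemma bijection_onto s y : exists x, val s x = y.
Proof.
by case/andP: (valP s) => _ /forallP/(_ y)/codomP[x ->]; exists x.
Qed.

Fact relabel_subproof s (p : {perm X}) : bijectiveb [ffun x => val s (p x)].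
Proof.
apply/andP; split.
  by apply/injectiveP=> x y; rewrite !ffunE => /bijection_inj/perm_inj.
apply/forallP=> y; have [x <-] := bijection_onto s y.
by apply/codomP; exists ((p^-1)%g x); rewrite ffunE permKV.
Qed.

Definition relabel s p : bijection X Y := Sub _ (relabel_subproof s p).

Definition swap s a b := relabel s (tperm a b).

Lemma relabelE s p x : val (relabel s p) x = val s (p x).
Proof. by rewrite SubK ffunE. Qed.

Lemma bijectionP s t : val s =1 val t -> s = t.
Proof. by move=> st; apply/val_inj/ffunP. Qed.

Lemma relabelM s p q : relabel (relabel s p) q = relabel s (q * p)%g.
Proof. by apply: bijectionP => x; rewrite !relabelE permM. Qed.

Lemma swapxx s a : swap s a a = s.
Proof. by apply: bijectionP => x; rewrite relabelE tperm1 perm1. Qed.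

Lemma FS_edgeP s t :
  reflect (exists a b, [/\ sedge a b, sedge (val s a) (val s b) & t = swap s a b])
          (FS_edge s t).
Proof.
apply: (iffP existsP) => [[a /existsP[b /and5P[ab Xab Yab sa /andP[sb]]]]|].
  move=> /forallP st; exists a, b; split=> //; apply: bijectionP => x.
  rewrite relabelE; case: tpermP => [->|->|/eqP xa /eqP xb].
  - exact/esym/eqP.
  - exact/esym/eqP.
  - by have:= st x; rewrite xa xb => /eqP.
case=> a [b [Xab Yab ->]]; exists a; apply/existsP; exists b.
rewrite !relabelE tpermL tpermR !eqxx Xab Yab /=; apply/andP; split.
  by apply: contraTneq Xab => ->; rewrite sedge_irrefl.
apply/forallP=> c; apply/implyP=> /andP[ca cb].
by rewrite relabelE tpermD // eq_sym.
Qed.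

Lemma FS_swap s a b :
  sedge a b -> sedge (val s a) (val s b) -> FS_edge s (swap s a b).
Proof. by move=> Xab Yab; apply/FS_edgeP; exists a, b. Qed.

Lemma FS_connect_sym : connect_sym (@FS_edge X Y).
Proof. exact/sym_connect_sym/FS_edge_sym. Qed.

(** Automorphisms of the graph of positions act on the friends-and-strangers
    graph by precomposition. *)
Lemma relabel_connect (p : {perm X}) s t :
    (forall a b, sedge (p a) (p b) = sedge a b) ->
  connect (@FS_edge X Y) s t ->
  connect (@FS_edge X Y) (relabel s p) (relabel t p).
Proof.
move=> p_aut /connectP[q + ->]; elim: q s => //= u q IHq s /andP[su uq].
apply: connect_trans (IHq u uq); apply: connect1.
have [a [b [Xab Yab ->]]] := FS_edgeP _ _ su.
apply/FS_edgeP; exists ((p^-1)%g a), ((p^-1)%g b).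
rewrite -p_aut !relabelE !permKV; split=> //; apply: bijectionP => x.
by rewrite !relabelE (inj_tperm _ _ _ (@perm_inj _ p)) !permKV.
Qed.

Lemma bijection_of_seq (l : seq Y) y0 :
    uniq l -> size l = #|X| -> #|X| = #|Y| ->
  exists s, forall x : X, val s x = nth y0 l (enum_rank x).
Proof.
move=> l_uniq l_size XY.
have f_inj : injective (fun x : X => nth y0 l (enum_rank x)).
  move=> x y /eqP; rewrite nth_uniq ?l_size ?ltn_ord // => /eqP/val_inj.
  exact: enum_rank_inj.
have fP : bijectiveb [ffun x : X => nth y0 l (enum_rank x)].
  apply/andP; split; first by apply/injectiveP=> x y; rewrite !ffunE => /f_inj.
  apply/forallP=> y; have: y \in codom (fun x : X => nth y0 l (enum_rank x)).
    by apply: (inj_card_onto f_inj); rewrite XY.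
  by case/codomP=> x ->; apply/codomP; exists x; rewrite ffunE.
by exists (Sub _ fP) => x; rewrite SubK ffunE.
Qed.

End States.

(** * Edges of lollipops and dandelions *)

Section Edges.
Variables n k : nat.
Implicit Types x y : 'I_n.

(** Distance from the free end of the tail in the dandelion; the leaves all lie
    one step beyond the center [n - k]. *)
Definition depth x := minn x (n - k).+1.

Lemma dandelion_edgeE x y :
  dandelion_edge k x y = ((depth x).+1 == depth y) || ((depth y).+1 == depth x).
Proof. by rewrite /dandelion_edge /tail_edge /star_edge /depth; lia. Qed.

Lemma lollipop_edgeE x y :
  lollipop_edge k x y =
    dandelion_edge k x y || [&& n - k < x, n - k < y & x != y].
Proof.
rewrite /lollipop_edge /dandelion_edge /clique_edge /tail_edge /star_edge.
by have -> : (x != y) = (x != y :> nat) by []; lia.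
Qed.

End Edges.

Lemma card_ord_geq n m : #|[set q : 'I_n | m <= q]| = n - m.
Proof.
rewrite -sum1dep_card -(big_geq_mkord _ _ xpredT (fun=> 1)).
by rewrite sum_nat_const_nat muln1.
Qed.

Lemma tperm_ltn n (a b q : 'I_n) : q < a -> q < b -> tperm a b q = q.
Proof. by move=> qa qb; rewrite tpermD // -val_eqE /= gtn_eqF. Qed.

(** * Lollipops: connectedness of every induced subgraph of order at least k *)

Section Lollipop.
Variables (n k : nat) (Y : sgraph).
Hypotheses (k_gt0 : 0 < k) (k_le_n : k <= n) (card_Y : #|Y| = n).
Local Notation L := (lollipop n k).
Local Notation Lconnect := (connect (@FS_edge L Y)).
Implicit Types (s t : bijection L Y) (A B : {set Y}).

Definition leftmost_in A B s : bool :=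
  [exists p : 'I_n,
    (val s p \in A) && [forall q : 'I_n, (q < p) ==> (val s q \notin B)]].

Lemma leftmost_inP A B s :
  reflect (exists2 p : 'I_n, val s p \in A
                           & forall q : 'I_n, q < p -> val s q \notin B)
          (leftmost_in A B s).
Proof.
apply: (iffP existsP) => [[p /andP[pA /forallP qB]]|[p pA qB]]; exists p => //.
  by move=> q; apply/implyP.
by rewrite pA; apply/forallP=> q; apply/implyP/qB.
Qed.

(** Bounds the position of the leftmost member of [B]: when [k <= #|B|], it is
    at most [n - k]. *)
Lemma card_left_of s B p :
    p <= n -> (forall q : 'I_n, q < p -> val s q \notin B) ->
  p + #|B| <= n.
Proof.
move=> p_le_n left_p; rewrite -card_Y -(cardsC B) addnC leq_add2l.
pose f (q : 'I_p) : Y := val s (widen_ord p_le_n q).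
have f_inj : injective f.
  move=> q r fqr; apply: val_inj.
  by have /(congr1 val) := bijection_inj fqr.
have card_f : #|codom f| = p by rewrite (card_codom f_inj) card_ord.
rewrite -[leqLHS]card_f; apply/subset_leq_card/subsetP=> _ /codomP[q ->].
by rewrite inE left_p //= ltn_ord.
Qed.

(** The invariant of the lollipop. Take [A] a union of components of [B]. The
    leftmost member of [B] stands at [n - k] or below, so nobody can get around
    it, and a member of [B] can take its place only by swapping with it, hence
    only if both are in the same component. A swap with someone outside [B] moves
    it one step at most along the tail, or else into the clique; in the latter
    case it stands at [n - k] with [n - k] outsiders on its left, and another outsider
    on its right leaves fewer than [k] people for [B]. *)
Lemma leftmost_in_edge A B s t :
    k <= #|B| -> A \subset B ->
    (forall u v, u \in A -> v \in B -> sedge u v -> v \in A) ->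
  FS_edge s t -> leftmost_in A B s -> leftmost_in A B t.
Proof.
move=> k_le_B sAB A_closed.
case/FS_edgeP=> a [b [Xab Yab ->]] /leftmost_inP[p pA left_p].
wlog lt_ab : a b Xab Yab / a < b.
  move=> IH; case: (ltngtP a b) => [|ba|/val_inj ab]; first exact: IH.
    by rewrite /swap tpermC; apply: IH => //; rewrite sedge_sym.
  by move: Xab; rewrite ab sedge_irrefl.
have p_le : p <= n - k by have := card_left_of (ltnW (ltn_ord p)) left_p; lia.
have Xab_case : b = a.+1 :> nat \/ n - k <= a.
  by move: Xab; rewrite /= /lollipop_edge /tail_edge /clique_edge; lia.
have swapD (q : 'I_n) : q != a :> nat -> q != b :> nat ->
    val (swap s a b) q = val s q.
  by move=> qa qb; rewrite relabelE tpermD // eq_sym.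
have swapL : val (swap s a b) a = val s b by rewrite relabelE tpermL.
have swapR : val (swap s a b) b = val s a by rewrite relabelE tpermR.
apply/leftmost_inP.
have [lt_ap|lt_pa|/val_inj a_p] := ltngtP a p.
- (* [p < b] would need an edge jumping over [p] on the tail. *)
  have [lt_bp|lt_pb|/val_inj b_p] := ltngtP b p; last 1 first.
  + exists a => [|q q_a]; first by rewrite swapL b_p.
    by rewrite swapD ?left_p //; lia.
  + exists p => [|q q_p]; first by rewrite swapD //; lia.
    have [->|q_a] := eqVneq q a; first by rewrite swapL left_p.
    have [->|q_b] := eqVneq q b; first by rewrite swapR left_p.
    by rewrite swapD ?left_p.
  + lia.
- exists p => [|q q_p]; first by rewrite swapD //; lia.
  by rewrite swapD ?left_p //; lia.
subst p; have left_swap (q : 'I_n) : q < a -> val (swap s a b) q \notin B.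
  by move=> q_a; rewrite swapD ?left_p //; lia.
have [sbB|sbB] := boolP (val s b \in B).
  by exists a => //; rewrite swapL; apply: A_closed pA sbB Yab.
have left_swap_a (q : 'I_n) : q < a.+1 -> val (swap s a b) q \notin B.
  rewrite ltnS leq_eqVlt => /predU1P[/val_inj->|]; last exact: left_swap.
  by rewrite swapL.
(* A clique edge is excluded here: [a.+1] people outside [B] on the left of
   [a.+1] force [a < n - k]. *)
exists b => [|q]; first by rewrite swapR.
suff -> : b = a.+1 :> nat by exact: left_swap_a.
by have := card_left_of (ltn_ord a) left_swap_a; lia.
Qed.

Lemma bijection_at s x y : exists t, val t x = y.
Proof.
have [p sp] := bijection_onto s y; exists (swap s x p).
by rewrite relabelE tpermL.
Qed.

(** Anyone in [B] becomes its leftmost member when put at the free end; start with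
    [x] there, end with [y] there, and apply the invariant to the component of
    [x]. *)
Lemma lollipop_connected_necessary :
  connected (FS L Y) -> forall B, k <= #|B| -> induced_connected B.
Proof.
case=> /card_gt0P[s0 _] FS_conn B k_le_B x y xB yB.
pose A := [set z in B | connect (induced_edge B) x z].
have n_gt0 : 0 < n by lia.
have [s sx] := bijection_at s0 (Ordinal n_gt0) x.
have [t ty] := bijection_at s0 (Ordinal n_gt0) y.
have: leftmost_in A B t.
  have: leftmost_in A B s.
    apply/leftmost_inP; exists (Ordinal n_gt0) => //.
    by rewrite sx inE xB connect0.
  have /connectP[q + ->] := FS_conn s t.
  elim: q s {sx} => //= u q IHq s /andP[su uq] sAB.
  apply: IHq uq _; apply: leftmost_in_edge k_le_B _ _ su sAB.
    by apply/subsetP=> z; rewrite inE => /andP[].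
  move=> u1 v; rewrite !inE => /andP[u1B xu1] vB u1v; rewrite vB.
  by apply: connect_trans xu1 (connect1 _); rewrite /induced_edge u1B vB.
case/leftmost_inP=> p pA left_p.
have [p0|p_gt0] := posnP p; last first.
  by have := left_p (Ordinal n_gt0) p_gt0; rewrite ty yB.
have tp : val t p = y by rewrite -ty; congr (val t _); apply/val_inj.
by move: pA; rewrite tp inE => /andP[].
Qed.

Definition occupants_from m s := [set val s q | q in [set q : 'I_n | m <= q]].

Lemma mem_occupants_from m s q :
  (val s q \in occupants_from m s) = (m <= q).
Proof. by rewrite mem_imset ?inE //; apply: bijection_inj. Qed.

Lemma card_occupants_from m s : #|occupants_from m s| = n - m.
Proof.
by rewrite card_imset ?card_ord_geq //; apply: bijection_inj.
Qed.

Hypothesis Y_conn : forall B, k <= #|B| -> induced_connected B.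

(** The people in the clique induce a connected graph, and a transposition of
    two of them is a product of transpositions of friends along a path. The
    induction along the path needs the claim for all placements that differ only
    inside the clique from [s], the intermediate ones being of that kind. *)
Lemma clique_swap s (a b : 'I_n) :
  n - k <= a -> n - k <= b -> Lconnect s (swap s a b).
Proof.
move=> a_ge b_ge.
have lollipop_clique (c e : 'I_n) :
    n - k <= c -> n - k <= e -> c != e -> sedge (c : L) e.
  move=> c_ge e_ge ce.
  by rewrite /= /lollipop_edge /clique_edge c_ge e_ge ce orbT.
have FS_clique s1 (c e : 'I_n) : n - k <= c -> n - k <= e -> c != e ->
    sedge (val s1 c) (val s1 e) -> Lconnect s1 (swap s1 c e).
  by move=> c_ge e_ge ce Yce; apply/connect1/FS_swap; rewrite ?lollipop_clique.
pose B := occupants_from (n - k) s.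
have k_le_B : k <= #|B| by rewrite card_occupants_from subKn.
have aB : val s a \in B by rewrite mem_occupants_from.
have bB : val s b \in B by rewrite mem_occupants_from.
pose exchangeable y := forall s1 (c : 'I_n),
  (forall q : 'I_n, q < n - k -> val s1 q = val s q) ->
  n - k <= c -> val s1 a = val s a -> val s1 c = y -> Lconnect s1 (swap s1 a c).
suff: exchangeable (val s b) by apply.
apply: (induced_connect_ind (Y_conn k_le_B aB bB)).
  by move=> s1 c _ _ <- /bijection_inj->; rewrite swapxx connect0.
move=> y y' yB y'B yy' IHy s1 c' s1s c'_ge s1a s1c'.
have [c s1c] := bijection_onto s1 y.
have c_ge : n - k <= c.
  rewrite leqNgt; apply/negP=> c_lt; move: yB.
  by rewrite -s1c s1s // mem_occupants_from leqNgt c_lt.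
have cc' : c != c'.
  by apply: contraTneq yy' => cc'; rewrite -s1c -s1c' cc' sedge_irrefl.
have [->|ac'] := eqVneq a c'; first by rewrite swapxx connect0.
have [->|ac] := eqVneq a c.
  by apply: FS_clique; rewrite ?s1c ?s1c'.
(* With [y] at [c] and its friend [y'] at [c'], the exchange of [val s a] and [y']
   is the exchange of [y] and [y'], then of [val s a] and [y], then again of [y]
   and [y']; the friends stand at [a] and [c] when they swap back. *)
have step1 : Lconnect s1 (swap s1 c c') by apply: FS_clique; rewrite ?s1c ?s1c'.
apply: connect_trans step1 _.
set s2 := swap s1 c c'.
have step2 : Lconnect s2 (swap s2 a c').
  apply: IHy => // [q q_lt||].
  - by rewrite relabelE tperm_ltn ?s1s // (leq_trans q_lt).
  - by rewrite relabelE tpermD // eq_sym.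
  - by rewrite relabelE tpermR.
apply: connect_trans step2 _.
have -> : swap s1 a c' = swap (swap s2 a c') a c.
  rewrite /swap !relabelM; congr relabel.
  rewrite [(tperm a c * _)%g]conjgC tpermJ tpermL tpermD // 1?eq_sym //.
  by rewrite -mulgA [tperm c' c]tpermC tperm2 mulg1.
apply: FS_clique => //; rewrite !relabelE.
by rewrite tpermL tpermR (@tpermD _ a c' c) // 1?eq_sym // tpermL s1c s1c'.
Qed.

(** Downward induction on [m]: it is enough to bring the right person to position
    [m] without disturbing the positions below. In the clique a transposition
    does it. On the tail, the people standing from [m] on number more than [k]
    and induce a connected graph; if one of them can be brought to [m], then so
    can each of their friends, who is first sent to [m.+1] by the induction
    hypothesis and then swaps with them. *)
Lemma agree_connect m s t :
    m <= n -> (forall q : 'I_n, q < m -> val s q = val t q) -> Lconnect s t.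
Proof.
move: {2}(n - m) (leqnn (n - m)) => r.
elim: r m s t => [|r IHr] m s t m_r m_le_n st.
  suff -> : s = t by exact: connect0.
  by apply: bijectionP => q; apply: st; have := ltn_ord q; lia.
have [m_n|m_lt_n] : m = n \/ m < n by lia.
  by apply: IHr m_le_n st; lia.
pose m' := Ordinal m_lt_n.
have agreeS s1 t1 : (forall q : 'I_n, q < m -> val s1 q = val t1 q) ->
    val s1 m' = val t1 m' -> Lconnect s1 t1.
  move=> st1 st1m; apply: (IHr m.+1) => //; first by lia.
  move=> q; rewrite ltnS leq_eqVlt => /predU1P[qm|]; last exact: st1.
  by have -> : q = m' by exact: val_inj.
have [p sp] := bijection_onto s (val t m').
have p_ge : m <= p.
  rewrite leqNgt; apply/negP=> p_lt; have /bijection_inj pm : val t p = val t m'.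
    by rewrite -st.
  by move: p_lt; rewrite pm /= ltnn.
have [m_ge|m_lt] := leqP (n - k) m.
  have s_swap : Lconnect s (swap s m' p).
    exact: clique_swap (leq_trans m_ge p_ge).
  apply: connect_trans s_swap _.
  apply: agreeS => [q q_m|]; last by rewrite relabelE tpermL.
  by rewrite relabelE tperm_ltn ?st // (leq_trans q_m).
pose B := occupants_from m s.
have k_le_B : k <= #|B| by rewrite card_occupants_from; lia.
have smB : val s m' \in B by rewrite mem_occupants_from /=.
have tmB : val t m' \in B by rewrite -sp mem_occupants_from.
pose reaches y := exists s1, [/\ Lconnect s s1, val s1 m' = y
  & forall q : 'I_n, q < m -> val s1 q = val s q].
have [s1 [ss1 s1m s1s]] : reaches (val t m'); last first.
  apply: connect_trans ss1 _; apply: agreeS => // q q_lt.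
  by rewrite s1s ?st.
apply: (induced_connect_ind (Y_conn k_le_B smB tmB)); first by exists s.
move=> y y' yB y'B yy' [s1 [ss1 s1m s1s]].
have m1_lt : m.+1 < n by lia.
pose m1 := Ordinal m1_lt.
have [c s1c] := bijection_onto s1 y'.
have c_ge : m < c.
  rewrite ltn_neqAle; apply/andP; split.
    apply: contraTneq yy' => mc; rewrite -s1m -s1c.
    by have -> : c = m' by [apply: val_inj]; rewrite sedge_irrefl.
  rewrite leqNgt; apply/negP=> c_lt; move: y'B.
  by rewrite -s1c s1s // mem_occupants_from leqNgt c_lt.
pose s2 := swap s1 m1 c.
have s1s2 : Lconnect s1 s2.
  apply: agreeS => [q q_lt|]; rewrite relabelE tperm_ltn //=.
    exact: ltnW.
  exact: ltn_trans q_lt c_ge.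
exists (swap s2 m' m1); split.
- apply: connect_trans ss1 (connect_trans s1s2 (connect1 _)).
  apply: FS_swap.
    by rewrite /= /lollipop_edge /tail_edge /= ltnW // m_lt eqxx.
  by rewrite !relabelE tpermL tperm_ltn /= ?s1c ?s1m.
- by rewrite !relabelE !tpermL.
- move=> q q_lt; have q_lt1 : q < m.+1 by exact: ltnW.
  by rewrite !relabelE !tperm_ltn ?s1s // (ltn_trans q_lt c_ge).
Qed.

Lemma lollipop_connected_sufficient : connected (FS L Y).
Proof.
split.
  have l_size : size (enum Y) = #|L| by rewrite -cardE card_Y card_ord.
  have L_Y : #|L| = #|Y| by rewrite card_Y card_ord.
  have /card_gt0P[y0 _] : 0 < #|Y| by rewrite card_Y; lia.
  have [s _] := bijection_of_seq y0 (enum_uniq Y) l_size L_Y.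
  by apply/card_gt0P; exists s.
by move=> s t; apply: (@agree_connect 0).
Qed.

End Lollipop.

(** * Dandelions: simulating the swaps of the clique *)

Lemma tperm_sandwich (T : finType) (c a b : T) : c != b -> a != b ->
  (tperm c a * tperm c b * tperm c a)%g = tperm a b.
Proof.
move=> cb ab.
by rewrite -{1}[tperm c a]tpermV -mulgA -conjgE tpermJ tpermL tpermD.
Qed.

Section Dandelion.
Variables (n k : nat) (Y : sgraph).
Local Notation L := (lollipop n k).
Local Notation D := (dandelion n k).
Local Notation Lconnect := (connect (@FS_edge L Y)).
Local Notation Dconnect := (connect (@FS_edge D Y)).
Implicit Types (s t : bijection D Y) (a b c : 'I_n) (B : {set Y}).

Lemma dandelion_connect_lollipop s t : Dconnect s t -> Lconnect s t.
Proof.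
apply: connect_sub => u _ /FS_edgeP[a [b [Dab Yab ->]]].
apply/connect1/FS_edgeP.
exists a, b; split=> //; last exact: val_inj.
by rewrite /= lollipop_edgeE; apply/orP; left.
Qed.

Lemma leaf_tperm_aut a b x y : n - k < a -> n - k < b ->
  dandelion_edge k (tperm a b x) (tperm a b y) = dandelion_edge k x y.
Proof.
move=> a_leaf b_leaf; suff depth_tperm z : depth k (tperm a b z) = depth k z.
  by rewrite !dandelion_edgeE !depth_tperm.
by rewrite /depth; case: tpermP => [->|->|//]; lia.
Qed.

Lemma leaf_swap_connect s t a b : n - k < a -> n - k < b ->
  Dconnect s t -> Dconnect (swap s a b) (swap t a b).
Proof.
by move=> a_leaf b_leaf; apply: relabel_connect => x y; apply: leaf_tperm_aut.
Qed.

(** Moving three mutual friends around the center exchanges those on the leaves: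
    this is the composite of three swaps along spokes. *)
Lemma triangle_swap s (c a b : 'I_n) :
    c = n - k :> nat -> n - k < a -> n - k < b -> a != b ->
    sedge (val s c) (val s a) -> sedge (val s c) (val s b) ->
    sedge (val s a) (val s b) ->
  Dconnect s (swap s a b).
Proof.
move=> c_center a_leaf b_leaf ab wu wv uv.
have spoke (e : 'I_n) : n - k < e -> sedge (c : D) e.
  move=> e_leaf.
  by rewrite /= /dandelion_edge /star_edge c_center eqxx e_leaf orbT.
have ca : c != a by rewrite -val_eqE /= c_center; lia.
have cb : c != b by rewrite -val_eqE /= c_center; lia.
have -> : swap s a b = swap (swap (swap s c a) c b) c a.
  rewrite /swap !relabelM; congr relabel.
  by rewrite tperm_sandwich.
have spoke_swap t (e : 'I_n) : n - k < e -> sedge (val t c) (val t e) ->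
    Dconnect t (swap t c e).
  by move=> e_leaf te; apply/connect1/FS_swap; first exact: spoke.
apply: connect_trans (spoke_swap _ _ a_leaf wu) _.
apply: connect_trans (spoke_swap _ b b_leaf _) (spoke_swap _ a a_leaf _).
  by rewrite !relabelE tpermL tpermD // eq_sym.
rewrite !relabelE tpermL (tpermD (x := c) (y := b) (z := a)) // 1?eq_sym //.
by rewrite tpermR (tpermD (x := c) (y := a) (z := b)) // sedge_sym.
Qed.

(** If the person at the center is a friend of all those on the leaves, and these
    induce a connected graph, then all transpositions of leaves are available:
    friends on leaves form triangles with the center, and the permutations [p] of
    the leaves such that [s] and [relabel s p] are connected form a group, since
    such permutations are automorphisms of the dandelion. *)
Lemma hub_swap s (c a b : 'I_n) B :
    c = n - k :> nat -> induced_connected B ->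
    (forall e, (val s e \in B) = (n - k < e)) ->
    (forall y, y \in B -> sedge (val s c) y) ->
  n - k < a -> n - k < b -> Dconnect s (swap s a b).
Proof.
move=> c_center B_conn leafE hub a_leaf b_leaf.
have aB : val s a \in B by rewrite leafE.
have bB : val s b \in B by rewrite leafE.
pose exchangeable y := forall e, val s e = y -> Dconnect s (swap s a e).
suff: exchangeable (val s b) by apply.
apply: (induced_connect_ind (B_conn _ _ aB bB)).
  by move=> e /bijection_inj->; rewrite swapxx connect0.
move=> y y' yB y'B yy' IHy e se.
have [b' sb'] := bijection_onto s y.
have b'_leaf : n - k < b' by rewrite -leafE sb'.
have e_leaf : n - k < e by rewrite -leafE se.
have b'e : b' != e.
  by apply: contraTneq yy' => b'e; rewrite -sb' b'e se sedge_irrefl.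
have step : Dconnect s (swap s b' e).
  by apply: triangle_swap c_center _ _ _ _ _ _; rewrite ?sb' ?se ?hub.
have [->|ab'] := eqVneq a b'; first by [].
have [->|ae] := eqVneq a e; first by rewrite swapxx connect0.
have -> : swap s a e = swap (swap (swap s b' e) a b') b' e.
  rewrite /swap !relabelM; congr relabel.
  by rewrite [tperm a b']tpermC tperm_sandwich 1?[tperm e a]tpermC // eq_sym.
apply: connect_trans (step) _; apply: leaf_swap_connect => //.
apply: connect_trans (IHy _ sb') _; exact: leaf_swap_connect.
Qed.

(** A lollipop edge is either an edge of the dandelion or joins two leaves. The
    transpositions of leaves being automorphisms of the dandelion, those that
    preserve the component of [s] when applied to [s] preserve it when applied
    anywhere in it. *)
Lemma swap_closed_connected s :
    (forall a b, n - k < a -> n - k < b -> Dconnect s (swap s a b)) ->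
  forall t, Lconnect s t -> Dconnect s t.
Proof.
move=> s_swap t /connectP[p sp ->].
suff from_s u : Dconnect s u -> path (@FS_edge L Y) u p -> Dconnect s (last u p).
  by apply: from_s sp; apply: connect0.
elim: p u {sp} => //= v p IHp u su /andP[uv vp]; apply: IHp vp.
apply: connect_trans (su) _.
case/FS_edgeP: uv => a [b [Lab Yab vE]].
have {v vE} -> : v = @swap D Y u a b by rewrite vE; apply: val_inj.
move: Lab; rewrite /= lollipop_edgeE => /orP[Dab|/and3P[a_leaf b_leaf _]].
  by apply/connect1/FS_edgeP; exists a, b.
have swap_su := leaf_swap_connect a_leaf b_leaf su.
apply: connect_trans (connect_trans (s_swap a b a_leaf b_leaf) swap_su).
by rewrite FS_connect_sym.
Qed.

Hypotheses (k_gt1 : 1 < k) (k_le_n : k <= n) (card_Y : #|Y| = n).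
Hypothesis Y_conn : forall B, k <= #|B| -> induced_connected B.

(** [w] is isolated in the graph induced by the complement of its neighborhood,
    so this complement, if it is not just [w], has fewer than [k] elements. *)
Lemma large_neighborhood (w : Y) : n - k < #|[set y | sedge w y]|.
Proof.
set N := [set y | _]; rewrite ltnNge; apply/negP => N_small.
have k_le : k <= #|~: N| by have := cardsC N; rewrite card_Y; lia.
have wN : w \in ~: N by rewrite !inE sedge_irrefl.
have /set0Pn[z] : ~: N :\ w != set0.
  by rewrite -card_gt0; have := cardsD1 w (~: N); rewrite wN; lia.
case/setD1P=> /eqP zw zN; apply: zw.
apply: (induced_connect_ind (P := fun y => y = w) (Y_conn k_le wN zN)) => //.
by move=> u v _ vN uv uw; move: vN; rewrite !inE -uw uv.
Qed.

(** This is where [2 * k - 1 <= n] enters: a neighborhood has at least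
    [n - k + 1 >= k] elements, so it is connected itself and contains a connected
    set of size [k - 1], to be spread over the leaves. *)
Lemma exists_hub : 2 * k - 1 <= n -> exists s c B,
  [/\ c = n - k :> nat, induced_connected B,
      forall e, (val s e \in B) = (n - k < e)
    & forall y, y \in B -> sedge (val s c) y].
Proof.
move=> n_ge; have /card_gt0P[w _] : 0 < #|Y| by rewrite card_Y; lia.
have N_large := large_neighborhood w.
have N_conn : induced_connected [set y | sedge w y] by apply: Y_conn; lia.
have [|B [sBN card_B B_conn]] := @induced_connected_subset Y _ k.-1 N_conn.
  by lia.
have wB : w \notin B.
  by apply/negP=> /(subsetP sBN); rewrite inE sedge_irrefl.
have card_wB : #|w |: B| = k by rewrite cardsU1 wB card_B; lia.
have card_rest : #|~: (w |: B)| = n - k.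
  by have := cardsC (w |: B); rewrite card_wB card_Y; lia.
pose l := enum (~: (w |: B)) ++ w :: enum B.
have l_uniq : uniq l.
  rewrite cat_uniq /= !enum_uniq !mem_enum wB !inE eqxx /= !andbT.
  by apply/hasPn=> y; rewrite !mem_enum !inE negbK => ->; rewrite orbT.
have l_size : size l = #|D|.
  by rewrite size_cat /= -!cardE card_rest card_B card_ord; lia.
have D_Y : #|D| = #|Y| by rewrite card_Y card_ord.
have [s sE] := bijection_of_seq w l_uniq l_size D_Y.
have {}sE e : val s e = nth w l e by rewrite sE enum_rank_ord.
have c_lt : n - k < n by lia.
have s_center : val s (Ordinal c_lt) = w.
  by rewrite sE nth_cat /= -cardE card_rest ltnn subnn.
exists s, (Ordinal c_lt), B; split=> // [e|y yB]; last first.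
  by rewrite s_center; have := subsetP sBN y yB; rewrite inE.
have [e_lt|e_gt|e_eq] := ltngtP e (n - k).
- rewrite sE nth_cat -cardE card_rest e_lt.
  have: nth w (enum (~: (w |: B))) e \in ~: (w |: B).
    by rewrite -mem_enum mem_nth // -cardE card_rest.
  by rewrite !inE negb_or => /andP[_ /negbTE].
- rewrite sE nth_cat -cardE card_rest ltnNge ltnW //=.
  have -> : e - (n - k) = (e - (n - k)).-1.+1 by lia.
  rewrite /= -mem_enum mem_nth // -cardE card_B.
  by have := ltn_ord e; lia.
- have -> : e = Ordinal c_lt by exact: val_inj.
  by rewrite s_center (negbTE wB).
Qed.

End Dandelion.

Lemma lollipop_connected_dandelion (n k : nat) (Y : sgraph) :
    1 < k -> 2 * k - 1 <= n -> #|Y| = n ->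
  connected (FS (lollipop n k) Y) <-> connected (FS (dandelion n k) Y).
Proof.
move=> k_gt1 n_ge card_Y; have k_le_n : k <= n by lia.
split=> -[FS_gt0 FS_conn]; (split; first exact: FS_gt0) => s t; last first.
  exact/dandelion_connect_lollipop/FS_conn.
have Y_conn : forall B : {set Y}, k <= #|B| -> induced_connected B.
  by apply: (lollipop_connected_necessary (ltnW k_gt1) k_le_n card_Y).
have [s0 [c [B [c_center B_conn leafE hub]]]] :=
  exists_hub k_gt1 k_le_n card_Y Y_conn n_ge.
have from_s0 u : connect (@FS_edge (dandelion n k) Y) s0 u.
  apply: swap_closed_connected (FS_conn s0 u) => a b.
  exact: hub_swap c_center B_conn leafE hub.
have to_s0 : connect (@FS_edge (dandelion n k) Y) s s0.
  by rewrite FS_connect_sym; apply: from_s0.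
exact: (connect_trans to_s0 (from_s0 t)).
Qed.

(** * The parity obstruction for two bipartite graphs *)

Section Parity.
Variables (X Y : sgraph) (cX : pred X) (cY : pred Y).
Hypothesis cX_proper : forall a b, sedge a b -> cX a != cX b.
Hypothesis cY_proper : forall u v, sedge u v -> cY u != cY v.
Implicit Types s t : bijection X Y.

Definition color_parity s := \big[addb/false]_x (cX x && cY (val s x)).

(** Of the two people who swap, exactly one has color [cY], and this one moves
    into or out of the positions of color [cX]. *)
Lemma color_parity_edge s a b : sedge a b -> sedge (val s a) (val s b) ->
  color_parity (swap s a b) = ~~ color_parity s.
Proof.
move=> Xab Yab; have ba : b != a.
  by apply: contraTneq Xab => ->; rewrite sedge_irrefl.
rewrite /color_parity !(bigD1 a isT) /= !(bigD1 b ba) /=.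
rewrite !relabelE tpermL tpermR.
rewrite (eq_bigr (fun x => cX x && cY (val s x))); last first.
  by move=> x /andP[xa xb]; rewrite relabelE tpermD // eq_sym.
move: (cX_proper Xab) (cY_proper Yab); case: (cX a) (cX b) => [] [] //= _;
  by case: (cY _) (cY _) => [] [] //= _; case: (\big[_/_]_(_ | _) _).
Qed.

Lemma color_parity_swap s a b : cX a = cX b ->
  color_parity (swap s a b) = color_parity s.
Proof.
move=> cXab; rewrite /color_parity (reindex_inj (@perm_inj _ (tperm a b))).
apply: eq_bigr => x _; rewrite relabelE tpermK; congr (_ && _).
by case: tpermP => [->|->|].
Qed.

(** Each move changes both the color parity and the signature. *)
Lemma bipartite_FS_parity s t : connect (@FS_edge X Y) s t ->
  exists2 p : {perm X}, t = relabel s p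
                      & odd_perm p = color_parity s (+) color_parity t.
Proof.
case/connectP=> q + ->; elim: q s => /= [|u q IHq] s.
  move=> _; exists 1%g; last by rewrite odd_perm1 addbb.
  by apply: bijectionP => x; rewrite relabelE perm1.
case/andP=> /FS_edgeP[a [b [Xab Yab ->]]] /IHq[p -> p_odd].
exists (p * tperm a b)%g; first by rewrite relabelM.
have ab : a != b by apply: contraTneq Xab => ->; rewrite sedge_irrefl.
by rewrite odd_permM odd_tperm ab p_odd color_parity_edge // addbT addNb negbK.
Qed.

(** Exchanging the people at two positions of the same color changes the
    signature but not the color parity. *)
Lemma bipartite_FS_disconnected a b :
  a != b -> cX a = cX b -> ~ connected (FS X Y).
Proof.
move=> ab cXab [/card_gt0P[s _] FS_conn].
have [p sp] := bipartite_FS_parity (FS_conn s (swap s a b)).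
suff <- : tperm a b = p by rewrite odd_tperm ab color_parity_swap // addbb.
apply/permP=> x; apply: (@bijection_inj _ _ s).
by rewrite -!relabelE -sp.
Qed.

End Parity.

(** * Complete bipartite graphs *)

Section CutGraph.
Variables (T : finType) (c : pred T).

Definition cut_edge : rel T := fun x y => c x != c y.

Fact cut_edge_sym : symmetric cut_edge.
Proof. by move=> x y; rewrite /cut_edge eq_sym. Qed.

Fact cut_edge_irrefl : irreflexive cut_edge.
Proof. by move=> x; rewrite /cut_edge eqxx. Qed.

Definition cut_graph := SGraph cut_edge_sym cut_edge_irrefl.

Lemma cut_graph_induced_connected (B : {set cut_graph}) u v :
  u \in B -> v \in B -> c u -> ~~ c v -> induced_connected B.
Proof.
move=> uB vB cu cv.
have edge (x y : cut_graph) : x \in B -> y \in B -> c x != c y ->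
    connect (induced_edge B) x y.
  by move=> xB yB xy; apply: connect1; rewrite /induced_edge xB yB.
have to_u x : x \in B -> connect (induced_edge B) x u.
  move=> xB; have [cx|cx] := boolP (c x).
    by apply: (@connect_trans _ _ v); apply: edge;
      rewrite // ?cx ?cu (negbTE cv).
  by rewrite edge // (negbTE cx) cu.
move=> x y xB yB; apply: connect_trans (to_u x xB) _.
by rewrite induced_connect_sym to_u.
Qed.

End CutGraph.

(** The complete bipartite graph with sides of [n - k + 1] and [k - 1] people
    separates the two families: as [n - k + 1 < k], no side contains [k] people,
    so the lollipop criterion holds, while dandelions are trees and therefore
    bipartite. *)
Lemma lollipop_dandelion_differ (n k : nat) :
    2 < k -> k <= n -> n <= 2 * k - 2 ->
  exists Y : sgraph, [/\ #|Y| = n, connected (FS (lollipop n k) Y)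
                       & ~ connected (FS (dandelion n k) Y)].
Proof.
move=> k_gt2 k_le_n n_le.
pose low : pred 'I_n := fun x => x <= n - k.
have card_high : #|[set x | ~~ low x]| = k.-1.
  rewrite (eq_card (B := [set x : 'I_n | n - k < x])) ?card_ord_geq.
    by lia.
  by move=> x; rewrite !inE ltnNge.
have card_low : #|[set x | low x]| = (n - k).+1.
  have <- : ~: [set x | ~~ low x] = [set x | low x].
    by apply/setP=> x; rewrite !inE negbK.
  have := cardsC [set x | ~~ low x]; rewrite card_high card_ord; lia.
exists (cut_graph low); split; first exact: card_ord.
  apply: lollipop_connected_sufficient => //; first by lia.
    exact: card_ord.
  move=> B B_large.
  have /subsetPn[u uB] : ~~ (B \subset [set x | ~~ low x]).
    apply: contraL B_large => /subset_leq_card.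
    by rewrite card_high -ltnNge; lia.
  rewrite inE negbK => u_low.
  have /subsetPn[v vB] : ~~ (B \subset [set x | low x]).
    apply: contraL B_large => /subset_leq_card.
    by rewrite card_low -ltnNge; lia.
  rewrite inE => v_high.
  exact: cut_graph_induced_connected uB vB u_low v_high.
(* Two leaves have the same color. *)
have last_lt : n.-1 < n by lia.
have prev_lt : n.-2 < n by lia.
pose color (x : dandelion n k) := odd (depth k x).
have color_proper a b : sedge a b -> color a != color b.
  by rewrite /= dandelion_edgeE /color => /orP[] /eqP <- /=; case: odd.
have low_proper (u v : cut_graph low) : sedge u v -> low u != low v by [].
apply: (bipartite_FS_disconnected color_proper low_proper
          (a := Ordinal last_lt) (b := Ordinal prev_lt)).
  by rewrite -val_eqE /=; lia.
by rewrite /color /depth /=; congr odd; lia.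
Qed.

Theorem proposition4p3 (n k : nat) (k_ge2 : 2 <= k) (k_le_n : k <= n) :
  (2 * k - 1 <= n ->
     forall Y : sgraph, #|Y| = n ->
       connected (FS (lollipop n k) Y) <-> connected (FS (dandelion n k) Y)) /\
  (3 <= k -> n <= 2 * k - 2 ->
     ~ forall Y : sgraph, #|Y| = n ->
         connected (FS (lollipop n k) Y) <-> connected (FS (dandelion n k) Y)).
Proof.
split=> [n_ge Y card_Y|k_ge3 n_le all_Y].
  exact: lollipop_connected_dandelion.
have [Y [card_Y L_conn D_disconn]] :=
  lollipop_dandelion_differ k_ge3 k_le_n n_le.
have [to_dandelion _] := all_Y Y card_Y.
exact: (D_disconn (to_dandelion L_conn)).
Qed.
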